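(* There exists an analytic univalent function $f$ on $\mathbb{D}=\{z\in\mathbb{C}:|z|<1\}$ with $f(0)=0$, $f'(0)=1$ such that the interior of $U_f=\{c\in\mathbb{C}: K_c[f]\text{ is univalent on }\mathbb{D}\}$ has at least two connected components.
   Context: Let $\operatorname{Log}(f(z)/z)$ denote the branch of $\log(f(z)/z)$ on $\mathbb{D}$ vanishing at $z=0$, and for $c\in\mathbb{C}$ set $K_c[f](z)=z\exp\big(c\operatorname{Log}(f(z)/z)\big)$. *)

(* Defs.v *)
From Stdlib Require Import Reals.
From Coquelicot Require Import Coquelicot.
Open Scope R_scope.

Definition in_disc (z : C) : Prop := Cmod z < 1.

Definition cexp (z : C) : C :=
  (exp (fst z) * cos (snd z), exp (fst z) * sin (snd z)).

Definition analytic_on_disc (f : C -> C) : Prop :=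
  forall z : C, in_disc z -> @ex_derive C_AbsRing C_NormedModule f z.

Definition univalent_on_disc (f : C -> C) : Prop :=
  analytic_on_disc f /\
  (forall z w : C, in_disc z -> in_disc w -> f z = f w -> z = w).

(* g is the branch of log(f(z)/z) on the disc vanishing at 0:
   g analytic on D, g 0 = 0 and exp(g z) = f z / z, i.e. f z = z exp(g z). *)
Definition is_Log_f_over_z (f g : C -> C) : Prop :=
  analytic_on_disc g /\ g (RtoC 0) = RtoC 0 /\
  (forall z : C, in_disc z -> f z = (z * cexp (g z))%C).

(* K_c[f](z) = z exp(c Log(f(z)/z)), with g = Log(f(z)/z). *)
Definition K_op (g : C -> C) (c : C) : C -> C :=
  fun z => (z * cexp (c * g z))%C.

Definition U_set (g : C -> C) (c : C) : Prop := univalent_on_disc (K_op g c).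

Definition interior_set (S : C -> Prop) (c : C) : Prop := locally c S.

Definition connected_set (Q : C -> Prop) : Prop :=
  forall A B : C -> Prop, open A -> open B ->
    (forall z, Q z -> A z \/ B z) ->
    (exists z, Q z /\ A z) -> (exists z, Q z /\ B z) ->
    exists z, Q z /\ A z /\ B z.

Definition same_component (S : C -> Prop) (a b : C) : Prop :=
  exists Q : C -> Prop, (forall z, Q z -> S z) /\ connected_set Q /\ Q a /\ Q b.

Definition at_least_two_components (S : C -> Prop) : Prop :=
  exists a b : C, S a /\ S b /\ ~ same_component S a b.

(* Main.v *)
Require Import Defs.
From Stdlib Require Import Reals Lra.
From Coquelicot Require Import Coquelicot.
Open Scope R_scope.

(* The function is f(z) = z exp(g(z)) with z g'(z) = z ((1 - z)^(i eps) - 1) and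
   eps small. K_c has a critical point where 1 + c z ((1 - z)^(i eps) - 1) = 0.
   On the real axis (1 - x)^(i eps) runs through the unit circle, and
   1/(1 - w) has real part 1/2 when |w| = 1, so the values of c with a critical
   point x in (0, 1) contain a curve, on which Re c = 1/(2 x), that separates 0
   from 1 and misses the interior of U_f.

   Univalence near c = 0 and c = 1: with u = 1 - z, v = 1 - w and |v| <= |u|,
   homogeneity and |r log r| <= C |1 - r| give
   u^(1 + i eps) - v^(1 + i eps) = u^(i eps) (u - v) + O(eps |u - v|).
   So g is Lipschitz, which settles small c. For c near 1, either |u| is bounded
   below, u^(i eps) is near 1 and g has a small Lipschitz constant, or z and w
   are both near 1, where log K_c has difference quotients of modulus near 1. *)

(** * Modulus inequalities and estimates for the complex exponential *)

Lemma Cmod_le_Rabs (z : C) : Cmod z <= Rabs (fst z) + Rabs (snd z).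
Proof.
  destruct z as [a b]; simpl.
  replace (a, b) with (RtoC a + Ci * RtoC b)%C
    by (apply injective_projections; simpl; ring).
  eapply Rle_trans; [apply Cmod_triangle|].
  rewrite Cmod_mult, Cmod_Ci, !Cmod_R; lra.
Qed.

Lemma Rabs_fst_le (z : C) : Rabs (fst z) <= Cmod z.
Proof. eapply Rle_trans; [apply Rmax_l | apply Rmax_Cmod]. Qed.

Lemma Rabs_snd_le (z : C) : Rabs (snd z) <= Cmod z.
Proof. eapply Rle_trans; [apply Rmax_r | apply Rmax_Cmod]. Qed.

Lemma Cmod_minus_sym (z w : C) : Cmod (z - w) = Cmod (w - z).
Proof. rewrite <- Cmod_opp; f_equal; ring. Qed.

Lemma Cmod_triangle_rev (z w : C) : Cmod z - Cmod w <= Cmod (z + w).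
Proof.
  assert (H := Cmod_triangle (z + w) (- w)).
  rewrite Cmod_opp in H. replace (z + w + - w)%C with z in H by ring. lra.
Qed.

Lemma Cmod_plus_le (z w : C) (a b : R) :
  Cmod z <= a -> Cmod w <= b -> Cmod (z + w) <= a + b.
Proof. assert (H := Cmod_triangle z w); lra. Qed.

Lemma Cmod_mult_le (z w : C) (a b : R) :
  Cmod z <= a -> Cmod w <= b -> Cmod (z * w) <= a * b.
Proof.
  intros Hz Hw; rewrite Cmod_mult.
  apply Rmult_le_compat; auto; apply Cmod_ge_0.
Qed.

Lemma cexp_plus (z w : C) : cexp (z + w) = (cexp z * cexp w)%C.
Proof.
  unfold cexp; apply injective_projections; simpl;
    rewrite exp_plus, ?cos_plus, ?sin_plus; ring.
Qed.

Lemma cexp_RtoC (x : R) : cexp (RtoC x) = RtoC (exp x).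
Proof.
  unfold cexp; apply injective_projections; simpl; rewrite ?cos_0, ?sin_0; ring.
Qed.

Lemma cexp_0 : cexp 0 = 1%C.
Proof. now rewrite cexp_RtoC, exp_0. Qed.

Lemma Cmod_cexp (z : C) : Cmod (cexp z) = exp (fst z).
Proof.
  unfold Cmod, cexp; simpl.
  replace (_ + _) with ((exp (fst z))²).
  - apply sqrt_Rsqr, Rlt_le, exp_pos.
  - assert (H := sin2_cos2 (snd z)); unfold Rsqr in *.
    transitivity (exp (fst z) * exp (fst z) *
      (sin (snd z) * sin (snd z) + cos (snd z) * cos (snd z))); [rewrite H|]; ring.
Qed.

Lemma cexp_neq_0 (z : C) : cexp z <> 0%C.
Proof. apply Cmod_gt_0; rewrite Cmod_cexp; apply exp_pos. Qed.

Lemma cexp_opp (z : C) : cexp (- z) = (/ cexp z)%C.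
Proof.
  assert (H := cexp_neq_0 z).
  assert (E : (cexp (- z) * cexp z)%C = 1%C).
  { rewrite <- cexp_plus. replace (- z + z)%C with (RtoC 0) by ring. apply cexp_0. }
  rewrite <- (Cmult_1_l (/ cexp z)), <- E. now field.
Qed.

Lemma Rabs_sin_le (x : R) : Rabs (sin x) <= Rabs x.
Proof.
  destruct (MVT_gen sin 0 x cos) as [c [_ Hc]].
  - intros; auto_derive; [easy | ring].
  - intros; apply continuity_sin.
  - rewrite sin_0, !Rminus_0_r in Hc. rewrite Hc, Rabs_mult.
    rewrite <- (Rmult_1_l (Rabs x)) at 2.
    apply Rmult_le_compat_r; [apply Rabs_pos|].
    apply Rabs_le; apply COS_bound.
Qed.

Lemma one_minus_cos (x : R) : 0 <= 1 - cos x <= x * x / 2.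
Proof.
  assert (B := COS_bound x). split; [lra|].
  replace x with (2 * (x / 2)) at 1 by field. rewrite cos_2a_sin.
  assert (H := Rabs_sin_le (x / 2)). apply Rsqr_le_abs_1 in H. unfold Rsqr in H. nra.
Qed.

Lemma Rabs_sin_minus_id (x : R) : Rabs x <= 1 -> Rabs (sin x - x) <= x * x.
Proof.
  intros Hx.
  destruct (MVT_gen (fun t => sin t - t) 0 x (fun t => cos t - 1)) as [c [Hc E]].
  - intros; auto_derive; [easy | ring].
  - intros; apply continuity_pt_minus; [apply continuity_sin | apply derivable_continuous, derivable_id].
  - rewrite sin_0, !Rminus_0_r in E. rewrite E, Rabs_mult.
    assert (B := one_minus_cos c).
    assert (Hcx : Rabs c <= Rabs x).
    { unfold Rmin, Rmax in Hc; destruct (Rle_dec 0 x); unfold Rabs;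
        destruct (Rcase_abs c), (Rcase_abs x); lra. }
    rewrite (Rabs_left1 (cos c - 1)) by lra.
    assert (0 <= Rabs c) by apply Rabs_pos.
    replace (x * x) with (Rabs x * Rabs x) by (rewrite <- Rabs_mult; apply Rabs_pos_eq; nra).
    apply Rmult_le_compat_r; [lra|].
    replace (c * c) with (Rabs c * Rabs c) in B by (rewrite <- Rabs_mult; apply Rabs_pos_eq; nra).
    nra.
Qed.

Lemma Rabs_exp_minus_1 (x : R) : Rabs (exp x - 1) <= Rabs x * exp (Rabs x).
Proof.
  assert (H1 := exp_ineq1_le x). assert (H2 := exp_ineq1_le (- x)).
  assert (P := exp_pos x). assert (Q := exp_pos (- x)).
  assert (E : exp x * exp (- x) = 1) by (rewrite <- exp_plus, Rplus_opp_r; apply exp_0).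
  unfold Rabs; destruct (Rcase_abs (exp x - 1)), (Rcase_abs x); nra.
Qed.

Lemma exp_le_2 (x : R) : x <= 1 / 2 -> exp x <= 2.
Proof.
  intros Hx. assert (H := exp_ineq1_le (- x)). assert (P := exp_pos x).
  assert (E : exp x * exp (- x) = 1) by (rewrite <- exp_plus, Rplus_opp_r; apply exp_0).
  nra.
Qed.

Lemma Rabs_exp_minus_1_minus_id (x : R) : Rabs x <= 1 / 2 -> Rabs (exp x - 1 - x) <= 2 * (x * x).
Proof.
  intros Hx. apply Rabs_le_between in Hx.
  assert (H := exp_ineq1_le x). assert (H2 := exp_ineq1_le (- x)). assert (P := exp_pos x).
  assert (E : exp x * exp (- x) = 1) by (rewrite <- exp_plus, Rplus_opp_r; apply exp_0).
  assert (exp x * (1 - x) <= 1) by nra.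
  rewrite Rabs_pos_eq by lra. nra.
Qed.

(** Only the real part of [w] enters the exponential factor. This matters for
    [w = i eps log (v / u)], whose imaginary part [eps ln |v / u|] is unbounded. *)
Lemma Cmod_cexp_minus_1 (w : C) :
  Cmod (cexp w - 1) <= 2 * exp (Rabs (fst w)) * Cmod w.
Proof.
  destruct w as [a b].
  replace (a, b) with (RtoC a + (0, b))%C at 1 by (apply injective_projections; simpl; ring).
  rewrite cexp_plus, cexp_RtoC.
  replace (RtoC (exp a) * cexp (0, b) - 1)%C
    with (RtoC (exp a - 1) * cexp (0, b) + (cexp (0, b) - 1))%C
    by (rewrite RtoC_minus; ring).
  eapply Rle_trans; [apply Cmod_triangle|].
  rewrite Cmod_mult, Cmod_cexp, Cmod_R; simpl fst. rewrite exp_0, Rmult_1_r.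
  assert (H1 := Rabs_exp_minus_1 a).
  (* The square of the left side is [2 (1 - cos b)], which is at most [b^2]. *)
  assert (H2 : Cmod (cexp (0, b) - 1) <= Rabs b).
  { rewrite <- (Rabs_pos_eq (Cmod _)) by apply Cmod_ge_0.
    apply Rsqr_le_abs_0. unfold Rsqr.
    replace (Cmod (cexp (0, b) - 1) * Cmod (cexp (0, b) - 1))
      with (Cmod (cexp (0, b) - 1) ^ 2) by ring.
    rewrite Cmod2_alt. unfold cexp; simpl. rewrite exp_0.
    assert (S := sin2_cos2 b). unfold Rsqr in S. assert (B := one_minus_cos b). nra. }
  assert (H3 := Rabs_fst_le (a, b)). assert (H4 := Rabs_snd_le (a, b)).
  simpl fst in *; simpl snd in *.
  assert (0 <= Rabs a) by apply Rabs_pos.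
  assert (H5 := exp_ineq1_le (Rabs a)).
  nra.
Qed.

Lemma Cmod_cexp_minus_1_small (w : C) :
  Cmod w <= 1 / 2 -> Cmod (cexp w - 1) <= 4 * Cmod w.
Proof.
  intros Hw. assert (H := Cmod_cexp_minus_1 w).
  assert (H1 := Rabs_fst_le w). assert (H2 := exp_le_2 (Rabs (fst w))).
  assert (0 <= Cmod w) by apply Cmod_ge_0. nra.
Qed.

Lemma Cmod_cexp_taylor2 (w : C) :
  Cmod w <= 1 / 2 -> Cmod (cexp w - 1 - w) <= 8 * (Cmod w * Cmod w).
Proof.
  intros Hw.
  assert (Ha := Rabs_fst_le w). assert (Hb := Rabs_snd_le w).
  destruct w as [a b]; simpl fst in *; simpl snd in *.
  eapply Rle_trans; [apply Cmod_le_Rabs|]. unfold cexp; simpl.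
  set (m := Cmod (a, b)) in *.
  assert (E1 := Rabs_exp_minus_1_minus_id a ltac:(lra)).
  assert (E2 := Rabs_exp_minus_1 a). assert (E3 := exp_le_2 (Rabs a) ltac:(lra)).
  assert (E4 := exp_le_2 a). assert (Haa := Rle_abs a).
  assert (E5 := one_minus_cos b). assert (E6 := Rabs_sin_minus_id b ltac:(lra)).
  assert (E7 := Rabs_sin_le b). assert (P := exp_pos a).
  assert (Pa := Rabs_pos a). assert (Pb := Rabs_pos b).
  assert (Sa : a * a <= m * m) by (rewrite <- (Rabs_pos_eq (a * a)), Rabs_mult by nra; nra).
  assert (Sb : b * b <= m * m) by (rewrite <- (Rabs_pos_eq (b * b)), Rabs_mult by nra; nra).
  replace (exp a * cos b + - (1) + - a) with ((exp a - 1 - a) + - (exp a * (1 - cos b))) by ring.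
  replace (exp a * sin b + - 0 + - b) with ((exp a - 1) * sin b + (sin b - b)) by ring.
  assert (F1 : Rabs (exp a - 1 - a + - (exp a * (1 - cos b))) <= 3 * (m * m)).
  { eapply Rle_trans; [apply Rabs_triang|].
    rewrite Rabs_Ropp, (Rabs_pos_eq (exp a * _)) by nra. nra. }
  assert (F2 : Rabs ((exp a - 1) * sin b + (sin b - b)) <= 3 * (m * m)).
  { eapply Rle_trans; [apply Rabs_triang|]. rewrite Rabs_mult.
    assert (Rabs (exp a - 1) * Rabs (sin b) <= (2 * m) * m); [|lra].
    apply Rmult_le_compat; try apply Rabs_pos; try lra.
    eapply Rle_trans; [apply E2|]. nra. }
  nra.
Qed.

(** For [0 <= b <= 1/2] the quadratic bound gives [sin b >= b / 2]; beyond that monotonicity gives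
    [sin b >= 1/4], while [b <= PI / 2 <= 2]. *)
Lemma Rabs_le_sin (b : R) : Rabs b <= PI / 2 -> Rabs b <= 8 * Rabs (sin b).
Proof.
  assert (W : forall b, 0 <= b <= PI / 2 -> b <= 8 * sin b).
  { clear b. intros b Hb. assert (HPI := PI_4).
    destruct (Rle_dec b (1 / 2)) as [h | h].
    - assert (H := Rabs_sin_minus_id b). rewrite Rabs_pos_eq in H by lra.
      specialize (H ltac:(lra)). apply Rabs_le_between in H. nra.
    - assert (H := Rabs_sin_minus_id (1 / 2)). rewrite Rabs_pos_eq in H by lra.
      specialize (H ltac:(lra)). apply Rabs_le_between in H.
      assert (sin (1 / 2) < sin b) by (apply sin_increasing_1; lra). lra. }
  unfold Rabs at 1 2; destruct (Rcase_abs b); intros Hb.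
  - assert (H := W (- b) ltac:(lra)). rewrite sin_neg in H.
    assert (H1 := Rle_abs (- sin b)). rewrite Rabs_Ropp in H1. lra.
  - assert (H := W b ltac:(lra)). assert (H1 := Rle_abs (sin b)). lra.
Qed.

(** This is [|r log r| <= 9 |1 - r|] for [r = exp l] in the closed unit disc. The real part of [l]
    contributes 1 to the constant and the imaginary part 8: either the sine bound applies, or
    [cos b <= 0], so that [|1 - r| >= 1] while [|b| <= 4]. *)
Lemma Cmod_cexp_mult_le (l : C) :
  fst l <= 0 -> Rabs (snd l) <= PI -> Cmod (cexp l) * Cmod l <= 9 * Cmod (1 - cexp l).
Proof.
  destruct l as [a b]; simpl; intros Ha Hb.
  assert (H1 := Cmod_le_Rabs (a, b)); simpl in H1.
  rewrite Cmod_cexp; simpl.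
  assert (P := exp_pos a). assert (E1 := exp_ineq1_le (- a)).
  assert (E : exp a * exp (- a) = 1) by (rewrite <- exp_plus, Rplus_opp_r; apply exp_0).
  assert (F1 : exp a * Rabs a <= 1 - exp a) by (rewrite Rabs_left1 by lra; nra).
  assert (F2 : 1 - exp a <= Cmod (1 - cexp (a, b))).
  { assert (T := Cmod_triangle_rev 1 (- cexp (a, b))).
    rewrite Cmod_opp, Cmod_cexp, Cmod_1 in T. apply T. }
  assert (F3 : exp a * Rabs b <= 8 * Cmod (1 - cexp (a, b))).
  { assert (HPI := PI_4). assert (Pb := Rabs_pos b).
    destruct (Rle_dec (Rabs b) (PI / 2)) as [h | h].
    - assert (G := Rabs_snd_le (1 - cexp (a, b))). unfold cexp in G at 1; simpl in G.
      replace (0 + - (exp a * sin b)) with (- (exp a * sin b)) in G by ring.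
      rewrite Rabs_Ropp, Rabs_mult, (Rabs_pos_eq (exp a)) in G by lra.
      assert (S := Rabs_le_sin b h). nra.
    - assert (G := Rabs_fst_le (1 - cexp (a, b))). unfold cexp in G at 1; simpl in G.
      assert (cos b <= 0).
      { rewrite <- (Rabs_pos_eq (PI / 2)) in h by lra.
        replace (cos b) with (cos (Rabs b)).
        - apply cos_le_0; [|lra]. rewrite (Rabs_pos_eq (PI / 2)) in h by lra. lra.
        - unfold Rabs; destruct (Rcase_abs b); [apply cos_neg | easy]. }
      assert (G' := Rle_abs (1 + - (exp a * cos b))).
      nra. }
  nra.
Qed.

(** * The principal logarithm on the right half-plane *)

(** The arctangent is the argument only when the real part is positive; that half-plane contains
    [1 - z] for every [z] in the disc. *)
Definition Clog (u : C) : C := (ln (Cmod u), atan (snd u / fst u)).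

Lemma Cmod_pos_right (u : C) : 0 < fst u -> 0 < Cmod u.
Proof. intros Hu. assert (H := Rabs_fst_le u). assert (H1 := Rle_abs (fst u)). lra. Qed.

Lemma right_neq_0 (u : C) : 0 < fst u -> u <> 0%C.
Proof. intros Hu. now apply Cmod_gt_0, Cmod_pos_right. Qed.

Lemma cexp_Clog (u : C) : 0 < fst u -> cexp (Clog u) = u.
Proof.
  intros Hu. assert (Hm := Cmod_pos_right u Hu).
  unfold cexp, Clog; simpl. rewrite exp_ln, cos_atan, sin_atan by easy.
  assert (E : Cmod u = fst u * sqrt (1 + (snd u / fst u)²)).
  { rewrite <- (sqrt_Rsqr (fst u)) at 1 by lra. rewrite <- sqrt_mult.
    - unfold Cmod; f_equal; unfold Rsqr; field; lra.
    - apply Rle_0_sqr.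
    - assert (H := Rle_0_sqr (snd u / fst u)); lra. }
  assert (0 < sqrt (1 + (snd u / fst u)²)).
  { apply sqrt_lt_R0. assert (H := Rle_0_sqr (snd u / fst u)); lra. }
  rewrite E. apply injective_projections; simpl; field; lra.
Qed.

Lemma Rabs_snd_Clog (u : C) : Rabs (snd (Clog u)) < PI / 2.
Proof. unfold Clog; simpl. assert (H := atan_bound (snd u / fst u)). apply Rabs_def1; lra. Qed.

Lemma cexp_Clog_minus (u v : C) :
  0 < fst u -> 0 < fst v -> cexp (Clog v - Clog u) = (v / u)%C.
Proof.
  intros Hu Hv. unfold Cminus. rewrite cexp_plus, cexp_opp, !cexp_Clog by easy. easy.
Qed.

(** The bound for [|r log r|] at [r = v / u], multiplied by [|u|]. Both arguments lie within
    [PI / 2] of 0, so their difference stays within [PI]. *)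
Lemma Clog_dist (u v : C) :
  0 < fst u -> 0 < fst v -> Cmod v <= Cmod u ->
  Cmod v * Cmod (Clog v - Clog u) <= 9 * Cmod (u - v).
Proof.
  intros Hu Hv Hvu.
  assert (Hmu := Cmod_pos_right u Hu). assert (Hmv := Cmod_pos_right v Hv).
  assert (Hu0 := right_neq_0 u Hu).
  assert (H := Cmod_cexp_mult_le (Clog v - Clog u)).
  rewrite cexp_Clog_minus in H by easy.
  replace (1 - v / u)%C with ((u - v) / u)%C in H by now field.
  rewrite !Cmod_div in H by easy.
  assert (E : forall a b, a / Cmod u * b = / Cmod u * (a * b)) by (intros; field; lra).
  apply (Rmult_le_reg_l (/ Cmod u)); [now apply Rinv_0_lt_compat|].
  rewrite <- E. replace (/ Cmod u * (9 * Cmod (u - v))) with (9 * (Cmod (u - v) / Cmod u)) by (field; lra).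
  apply H.
  - simpl. destruct (Req_dec (Cmod v) (Cmod u)) as [-> | h]; [lra|].
    assert (ln (Cmod v) < ln (Cmod u)) by (apply ln_increasing; lra). lra.
  - assert (H1 := Rabs_snd_Clog u). assert (H2 := Rabs_snd_Clog v).
    unfold Cminus, Cplus, Copp; cbn [snd].
    eapply Rle_trans; [apply Rabs_triang|]. rewrite Rabs_Ropp. lra.
Qed.

(** [Clog_dist] carries the smaller of the two moduli as a factor, and here that is at least
    [|u| / 2]. *)
Lemma Clog_lipschitz (u v : C) :
  0 < fst u -> 0 < fst v -> Cmod u / 2 <= Cmod v ->
  Cmod (Clog v - Clog u) <= 18 / Cmod u * Cmod (v - u).
Proof.
  intros Hu Hv Huv.
  assert (Hmu := Cmod_pos_right u Hu).
  assert (D := Cmod_ge_0 (Clog v - Clog u)).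
  apply (Rmult_le_reg_l (Cmod u / 2)); [lra|].
  replace (Cmod u / 2 * (18 / Cmod u * Cmod (v - u))) with (9 * Cmod (v - u)) by (field; lra).
  destruct (Rle_dec (Cmod v) (Cmod u)) as [h | h].
  - assert (H := Clog_dist u v Hu Hv h). rewrite (Cmod_minus_sym v u). nra.
  - assert (H := Clog_dist v u Hv Hu ltac:(lra)). rewrite (Cmod_minus_sym (Clog u)) in H. nra.
Qed.

(** * Complex derivatives *)

(** An epsilon-delta form equivalent to the derivative over either normed module structure on C, so
    that rules available for one transfer to the other. *)
Definition cderiv (f : C -> C) (x l : C) : Prop :=
  forall e : R, 0 < e -> exists d : R, 0 < d /\
    forall y, Cmod (y - x) < d -> Cmod (f y - f x - (y - x) * l) <= e * Cmod (y - x).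

Lemma is_derive_cderiv (f : C -> C) (x l : C) :
  @is_derive C_AbsRing C_NormedModule f x l <-> cderiv f x l.
Proof.
  split.
  - intros [_ H] e He.
    destruct (H x (fun P p => p) (mkposreal e He)) as [d Hd].
    exists d; split; [apply cond_pos|]. intros y Hy. exact (Hd y Hy).
  - intros H. split; [apply (is_linear_scal_l (V := C_NormedModule) l)|].
    intros y Hy e.
    apply (is_filter_lim_locally_unique (V := AbsRing_NormedModule C_AbsRing)) in Hy. subst y.
    destruct (H e (cond_pos e)) as [d [Hd Hy]].
    exists (mkposreal d Hd). intros y By. exact (Hy y By).
Qed.

(* Coquelicot's product and chain rules live on this second normed module
   structure on C, which is not convertible to [C_NormedModule]. *)
Lemma is_derive_AbsRing_cderiv (f : C -> C) (x l : C) :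
  @is_derive C_AbsRing (AbsRing_NormedModule C_AbsRing) f x l <-> cderiv f x l.
Proof.
  split.
  - intros [_ H] e He.
    destruct (H x (fun P p => p) (mkposreal e He)) as [d Hd].
    exists d; split; [apply cond_pos|]. intros y Hy. exact (Hd y Hy).
  - intros H. split; [apply (is_linear_scal_l (V := AbsRing_NormedModule C_AbsRing) l)|].
    intros y Hy e.
    apply (is_filter_lim_locally_unique (V := AbsRing_NormedModule C_AbsRing)) in Hy. subst y.
    destruct (H e (cond_pos e)) as [d [Hd Hy]].
    exists (mkposreal d Hd). intros y By. exact (Hy y By).
Qed.

Lemma cderiv_plus (f g : C -> C) (x l m : C) :
  cderiv f x l -> cderiv g x m -> cderiv (fun y => f y + g y)%C x (l + m)%C.
Proof.
  rewrite <- !is_derive_cderiv.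
  exact (is_derive_plus (V := C_NormedModule) f g x l m).
Qed.

Lemma cderiv_mult (f g : C -> C) (x l m : C) :
  cderiv f x l -> cderiv g x m -> cderiv (fun y => f y * g y)%C x (l * g x + f x * m)%C.
Proof.
  rewrite <- !is_derive_AbsRing_cderiv. intros Hf Hg.
  exact (is_derive_mult (K := C_AbsRing) f g x l m Hf Hg Cmult_comm).
Qed.

Lemma cderiv_comp (f g : C -> C) (x l m : C) :
  cderiv f (g x) l -> cderiv g x m -> cderiv (fun y => f (g y)) x (m * l)%C.
Proof.
  intros Hf Hg. apply is_derive_cderiv in Hf. apply is_derive_AbsRing_cderiv in Hg.
  apply is_derive_cderiv. revert Hf Hg.
  exact (is_derive_comp (V := C_NormedModule) f g x l m).
Qed.

Lemma cderiv_const (a x : C) : cderiv (fun _ => a) x 0.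
Proof. rewrite <- is_derive_cderiv. exact (is_derive_const (V := C_NormedModule) a x). Qed.

Lemma cderiv_id (x : C) : cderiv (fun y => y) x 1.
Proof. rewrite <- is_derive_AbsRing_cderiv. exact (is_derive_id (K := C_AbsRing) x). Qed.

Lemma cderiv_quadratic (f : C -> C) (x l : C) (r K : R) :
  0 < r -> 0 <= K ->
  (forall y, Cmod (y - x) < r ->
     Cmod (f y - f x - (y - x) * l) <= K * (Cmod (y - x) * Cmod (y - x))) ->
  cderiv f x l.
Proof.
  intros Hr HK H e He. exists (Rmin r (e / (K + 1))). split.
  - apply Rmin_pos; [easy|]. apply Rdiv_lt_0_compat; lra.
  - intros y Hy. assert (H1 := Rmin_l r (e / (K + 1))). assert (H2 := Rmin_r r (e / (K + 1))).
    eapply Rle_trans; [apply H; lra|].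
    assert (D := Cmod_ge_0 (y - x)).
    assert (H3 : (K + 1) * Cmod (y - x) <= e).
    { apply (Rmult_le_reg_l (/ (K + 1))); [apply Rinv_0_lt_compat; lra|].
      rewrite <- Rmult_assoc, Rinv_l by lra. unfold Rdiv in *. lra. }
    nra.
Qed.

Lemma cderiv_cexp (x : C) : cderiv cexp x (cexp x).
Proof.
  apply (cderiv_quadratic _ _ _ (1 / 2) (8 * Cmod (cexp x))); [lra| |].
  - assert (H := Cmod_ge_0 (cexp x)); lra.
  - intros y Hy.
    replace (cexp y) with (cexp x * cexp (y - x))%C by (rewrite <- cexp_plus; f_equal; ring).
    replace (cexp x * cexp (y - x) - cexp x - (y - x) * cexp x)%C
      with (cexp x * (cexp (y - x) - 1 - (y - x)))%C by ring.
    rewrite Cmod_mult.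
    assert (H := Cmod_cexp_taylor2 (y - x) ltac:(lra)). assert (P := Cmod_ge_0 (cexp x)). nra.
Qed.

(* The increment [l] of the logarithm is O(h), and [exp l = 1 + h / x], so the
   Taylor bound for [exp] at [l] gives the derivative of its inverse. *)
Lemma cderiv_Clog (x : C) : 0 < fst x -> cderiv Clog x (/ x).
Proof.
  intros Hx. assert (Hm := Cmod_pos_right x Hx). assert (Hx0 := right_neq_0 x Hx).
  assert (Hfm : fst x <= Cmod x) by (assert (H := Rabs_fst_le x); assert (H1 := Rle_abs (fst x)); lra).
  set (M := 18 / Cmod x).
  assert (HM : 0 < M) by (apply Rdiv_lt_0_compat; lra).
  (* The radius keeps [y] in the half-plane and [|y| >= |x| / 2], and makes the logarithmic
     increment at most [M |x| / 36 = 1/2], as the Taylor bound requires. *)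
  apply (cderiv_quadratic _ _ _ (fst x / 36) (8 * (M * M))); [lra | nra |].
  intros y Hy.
  assert (Hyx : 0 < fst y).
  { assert (H := Rabs_fst_le (y - x)). apply Rle_lt_trans with (2 := Hy) in H.
    simpl in H. apply Rabs_def2 in H. lra. }
  assert (Hmy : Cmod x / 2 <= Cmod y).
  { assert (H := Cmod_triangle_rev x (y - x)). replace (x + (y - x))%C with y in H by ring. lra. }
  assert (L := Clog_lipschitz x y Hx Hyx Hmy). fold M in L.
  set (l := (Clog y - Clog x)%C) in *.
  assert (D := Cmod_ge_0 (y - x)). assert (Dl := Cmod_ge_0 l).
  assert (Hl : Cmod l <= 1 / 2).
  { eapply Rle_trans; [apply L|]. apply Rle_trans with (M * (Cmod x / 36)).
    - apply Rmult_le_compat_l; lra.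
    - unfold M. right. field. lra. }
  assert (T := Cmod_cexp_taylor2 l Hl). unfold l in T at 1. rewrite cexp_Clog_minus in T by easy.
  replace (y / x - 1 - l)%C with (- (l - (y - x) * / x))%C in T by now field.
  rewrite Cmod_opp in T. eapply Rle_trans; [apply T|]. nra.
Qed.

(** * The function [g] and its difference quotients *)

Definition eps : R := / 10000.
Definition ieps : C := (0, eps).

Definition pow_ieps (u : C) : C := cexp (ieps * Clog u).

(* [log (f z / z)]; its exact form makes [z f'/f = 1 - z + z (1 - z)^(i eps)]. *)
Definition spiral_log (z : C) : C :=
  ((1 - (1 - z) * pow_ieps (1 - z)) / (1 + ieps) - z)%C.

Lemma eps_val : eps = 1 / 10000.
Proof. unfold eps; lra. Qed.

Lemma Cmod_ieps : Cmod ieps = eps.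
Proof.
  unfold ieps. replace (0, eps) with (Ci * RtoC eps)%C by (apply injective_projections; simpl; ring).
  rewrite Cmod_mult, Cmod_Ci, Cmod_R, Rabs_pos_eq; rewrite ?eps_val; lra.
Qed.

Lemma Cmod_1_plus_ieps : 1 <= Cmod (1 + ieps).
Proof.
  assert (H := Rabs_fst_le (1 + ieps)). simpl in H. rewrite Rplus_0_r, Rabs_R1 in H. exact H.
Qed.

Lemma one_plus_ieps_neq_0 : (1 + ieps)%C <> 0%C.
Proof. apply Cmod_gt_0. assert (H := Cmod_1_plus_ieps); lra. Qed.

Lemma in_disc_right (z : C) : in_disc z -> 0 < fst (1 - z)%C.
Proof.
  unfold in_disc; intros Hz. assert (H := Rabs_fst_le z). assert (H1 := Rle_abs (fst z)).
  simpl; lra.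
Qed.

(** The modulus is [exp (- eps arg u)] with [|arg u| < PI / 2], so it stays near 1 however far the
    argument [eps ln |u|] winds. *)
Lemma Cmod_pow_ieps (u : C) : 99 / 100 <= Cmod (pow_ieps u) <= 101 / 100.
Proof.
  unfold pow_ieps. rewrite Cmod_cexp. unfold ieps. cbn [fst snd Cmult].
  assert (H := Rabs_snd_Clog u). assert (HPI := PI_4).
  set (x := 0 * fst (Clog u) - eps * snd (Clog u)).
  assert (Hx : - (2 / 10000) <= x <= 2 / 10000).
  { unfold x. rewrite eps_val. apply Rabs_def2 in H. lra. }
  assert (E1 := exp_ineq1_le x). assert (E2 := exp_ineq1_le (- x)).
  assert (E : exp x * exp (- x) = 1) by (rewrite <- exp_plus, Rplus_opp_r; apply exp_0).
  assert (P := exp_pos x). split; [lra | nra].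
Qed.

(** With [l = log v - log u] the left side is the modulus of [u^(i eps) v (exp (i eps l) - 1)]. The
    last factor is at most [4 eps |l|], and the factor [v] absorbs the singularity of the logarithm:
    [|v| |l| <= 9 |u - v|]. *)
Lemma pow_increment (u v : C) :
  0 < fst u -> 0 < fst v -> Cmod v <= Cmod u ->
  Cmod (u * pow_ieps u - v * pow_ieps v - pow_ieps u * (u - v)) <= 1 / 100 * Cmod (u - v).
Proof.
  intros Hu Hv Hvu.
  set (l := (Clog v - Clog u)%C).
  assert (E : pow_ieps v = (pow_ieps u * cexp (ieps * l))%C).
  { unfold pow_ieps. rewrite <- cexp_plus. f_equal. unfold l; ring. }
  rewrite E.
  replace (u * pow_ieps u - v * (pow_ieps u * cexp (ieps * l)) - pow_ieps u * (u - v))%C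
    with (- (pow_ieps u * (v * (cexp (ieps * l) - 1))))%C by ring.
  rewrite Cmod_opp, !Cmod_mult.
  assert (B := Clog_dist u v Hu Hv Hvu). fold l in B.
  assert (C1 := Cmod_cexp_minus_1 (ieps * l)).
  rewrite Cmod_mult, Cmod_ieps in C1.
  assert (C2 : exp (Rabs (fst (ieps * l)%C)) <= 2).
  { apply exp_le_2. unfold ieps. cbn [fst snd Cmult].
    assert (H1 := Rabs_snd_Clog u). assert (H2 := Rabs_snd_Clog v). assert (HPI := PI_4).
    apply Rabs_def2 in H1. apply Rabs_def2 in H2.
    replace (snd l) with (snd (Clog v) - snd (Clog u)) by (unfold l; simpl; ring).
    apply Rabs_le. rewrite eps_val. lra. }
  assert (W := Cmod_pow_ieps u).
  assert (D := Cmod_ge_0 l). assert (Dv := Cmod_ge_0 v). assert (Dd := Cmod_ge_0 (u - v)).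
  assert (C3 : Cmod (cexp (ieps * l) - 1) <= 4 * eps * Cmod l).
  { rewrite eps_val in *. nra. }
  assert (C4 : Cmod v * Cmod (cexp (ieps * l) - 1) <= 36 * eps * Cmod (u - v)).
  { apply Rle_trans with (4 * eps * (Cmod v * Cmod l)).
    - replace (4 * eps * (Cmod v * Cmod l)) with (Cmod v * (4 * eps * Cmod l)) by ring.
      now apply Rmult_le_compat_l.
    - rewrite eps_val in *. lra. }
  rewrite eps_val in C4.
  assert (0 <= Cmod v * Cmod (cexp (ieps * l) - 1)) by (apply Rmult_le_pos; [easy | apply Cmod_ge_0]).
  nra.
Qed.

(** The difference quotient of [g] is uniformly close to the derivative at [z], the point farther
    from 1, even where [u^(i eps)] oscillates. *)
Lemma spiral_log_increment (z w : C) :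
  in_disc z -> in_disc w -> Cmod (1 - w) <= Cmod (1 - z) ->
  exists k : C, Cmod k <= 1 / 50 /\
    (spiral_log w - spiral_log z = (pow_ieps (1 - z) + k - 1) * (w - z))%C.
Proof.
  intros Hz Hw Hzw.
  destruct (Ceq_dec w z) as [-> | Hne].
  { exists 0%C. split; [rewrite Cmod_0; lra | ring]. }
  assert (Hd : (w - z)%C <> 0%C).
  { intros H; apply Hne. replace w with (w - z + z)%C by ring. rewrite H. ring. }
  set (u := (1 - z)%C) in *. set (v := (1 - w)%C) in *.
  assert (I := pow_increment u v (in_disc_right z Hz) (in_disc_right w Hw) Hzw).
  set (R0 := (u * pow_ieps u - v * pow_ieps v - pow_ieps u * (u - v))%C) in I.
  assert (Huv : (u - v = w - z)%C) by (unfold u, v; ring).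
  rewrite Huv in I.
  assert (B0 := one_plus_ieps_neq_0). assert (B1 := Cmod_1_plus_ieps).
  (* Obtained by solving [(p + R0 / (w - z)) / (1 + i eps) = p + k] for [k], where
     [p = u^(i eps)]. *)
  exists ((R0 / (w - z) - ieps * pow_ieps u) / (1 + ieps))%C. split.
  - rewrite Cmod_div by easy.
    apply Rle_trans with (Cmod (R0 / (w - z) - ieps * pow_ieps u)).
    { assert (P := Cmod_ge_0 (R0 / (w - z) - ieps * pow_ieps u)).
      apply (Rmult_le_reg_r (Cmod (1 + ieps))); [lra|].
      unfold Rdiv. rewrite Rmult_assoc, Rinv_l by lra. nra. }
    unfold Cminus at 1. eapply Rle_trans; [apply Cmod_triangle|].
    rewrite Cmod_opp, Cmod_mult, Cmod_ieps, Cmod_div by easy.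
    assert (W := Cmod_pow_ieps u).
    assert (Cmod R0 / Cmod (w - z) <= 1 / 100).
    { apply Cmod_gt_0 in Hd. apply (Rmult_le_reg_r (Cmod (w - z))); [easy|].
      unfold Rdiv at 1. rewrite Rmult_assoc, Rinv_l by lra. lra. }
    rewrite eps_val. lra.
  - unfold spiral_log, R0. fold u v.
    replace (pow_ieps u * (u - v))%C with (pow_ieps u * (w - z))%C by (now rewrite Huv).
    field. split; easy.
Qed.

(** * Injectivity of [K_c] for [c] near 0 and near 1 *)

(* Two points identified by [K_c] satisfy a fixed-point equation for [z - w],
   in which [m] is a difference quotient of the logarithm. *)
Lemma K_op_collision (c z w : C) :
  in_disc z -> in_disc w -> Cmod (1 - w) <= Cmod (1 - z) ->
  K_op spiral_log c z = K_op spiral_log c w ->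
  exists m k : C, m = (pow_ieps (1 - z) + k)%C /\ Cmod k <= 1 / 50 /\
    (z - w = w * (cexp (c * (m - 1) * (w - z)) - 1))%C.
Proof.
  intros Hz Hw Hzw HK.
  destruct (spiral_log_increment z w Hz Hw Hzw) as [k [Hk E]].
  exists (pow_ieps (1 - z) + k)%C, k. split; [easy|]. split; [easy|].
  rewrite <- Cmult_assoc, <- E. unfold K_op in HK.
  replace (c * (spiral_log w - spiral_log z))%C
    with (c * spiral_log w + - (c * spiral_log z))%C by ring.
  rewrite cexp_plus, cexp_opp.
  assert (N := cexp_neq_0 (c * spiral_log z)).
  replace z with (z * cexp (c * spiral_log z) / cexp (c * spiral_log z))%C at 1 by (now field).
  rewrite HK. now field.
Qed.

Lemma Cmod_slope_le (u k : C) : Cmod k <= 1 / 50 -> Cmod (pow_ieps u + k - 1) <= 21 / 10.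
Proof.
  intros Hk. assert (W := Cmod_pow_ieps u).
  unfold Cminus. eapply Rle_trans; [apply Cmod_triangle|].
  rewrite Cmod_opp, Cmod_1. assert (H := Cmod_triangle (pow_ieps u) k). lra.
Qed.

Lemma in_disc_dist (z w : C) : in_disc z -> in_disc w -> Cmod (w - z) <= 2.
Proof.
  unfold in_disc; intros Hz Hw. unfold Cminus.
  assert (H := Cmod_triangle w (- z)). rewrite Cmod_opp in H. lra.
Qed.

(** Since [|w| < 1] and [|q (w - z)| <= 2/5], the linear bound for [exp] yields
    [|z - w| <= 4/5 |z - w|]. *)
Lemma collision_contraction (q z w : C) :
  in_disc z -> in_disc w -> Cmod q <= 1 / 5 ->
  (z - w = w * (cexp (q * (w - z)) - 1))%C -> z = w.
Proof.
  intros Hz Hw Hq E.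
  assert (D := in_disc_dist z w Hz Hw). assert (D0 := Cmod_ge_0 (w - z)).
  assert (Q0 := Cmod_ge_0 q).
  assert (B : Cmod (cexp (q * (w - z)) - 1) <= 4 * Cmod (q * (w - z))).
  { apply Cmod_cexp_minus_1_small. rewrite Cmod_mult. nra. }
  rewrite Cmod_mult in B.
  assert (F : Cmod (z - w) <= Cmod (cexp (q * (w - z)) - 1)).
  { rewrite E, Cmod_mult. assert (P := Cmod_ge_0 (cexp (q * (w - z)) - 1)).
    assert (P' := Cmod_ge_0 w). unfold in_disc in Hw. nra. }
  rewrite (Cmod_minus_sym z w) in F.
  assert (Z : Cmod (w - z) = 0) by nra.
  apply Cmod_eq_0 in Z. replace z with (w - (w - z))%C by ring. rewrite Z. ring.
Qed.

Lemma Cmod_pow_ieps_minus_1 (u : C) :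
  0 < fst u -> 1 / 1000 <= Cmod u <= 2 -> Cmod (pow_ieps u - 1) <= 1 / 100.
Proof.
  intros Hu [H1 H2].
  assert (L : Cmod (Clog u) <= 12).
  { eapply Rle_trans; [apply Cmod_le_Rabs|].
    assert (HA := Rabs_snd_Clog u). assert (HPI := PI_4).
    assert (Rabs (fst (Clog u)) <= 10); [|lra].
    unfold Clog; cbn [fst].
    (* From [e >= 2] and [2^10 = 1024]; hence [|ln |u|| <= 10] on the whole range of [u]. *)
    assert (G1 : 1000 <= exp 10).
    { assert (e1 := exp_ineq1_le 1).
      replace 10 with (1 + 1 + 1 + 1 + 1 + 1 + 1 + 1 + 1 + 1) by ring.
      rewrite !exp_plus.
      assert (P := pow_incr (1 + 1) (exp 1) 10 ltac:(lra)). simpl in P. lra. }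
    assert (G2 : exp (- (10)) <= 1 / 1000).
    { rewrite exp_Ropp. replace (1 / 1000) with (/ 1000) by field.
      apply Rinv_le_contravar; lra. }
    apply Rabs_le. split.
    - rewrite <- (ln_exp (- (10))). apply ln_le; [apply exp_pos | lra].
    - rewrite <- (ln_exp 10). apply ln_le; lra. }
  assert (I : Cmod (ieps * Clog u) <= 12 / 10000).
  { rewrite Cmod_mult, Cmod_ieps, eps_val. assert (P := Cmod_ge_0 (Clog u)). lra. }
  assert (T := Cmod_cexp_minus_1_small (ieps * Clog u) ltac:(lra)).
  unfold pow_ieps. lra.
Qed.

(** Near 1 the slope [m - 1] need not be small, so contraction fails. Instead the terms linear in
    [D = w - z] are collected: their coefficient [1 + c (m - 1) = c m - (c - 1)] is bounded away
    from 0 because [c] and [|m|] are near 1. *)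
Lemma collision_near_1 (c m z w : C) :
  in_disc z -> in_disc w -> Cmod (1 - z) <= 1 / 1000 -> Cmod (1 - w) <= 1 / 1000 ->
  Cmod (c - 1) <= 1 / 10 -> 97 / 100 <= Cmod m -> Cmod (m - 1) <= 21 / 10 ->
  (z - w = w * (cexp (c * (m - 1) * (w - z)) - 1))%C -> z = w.
Proof.
  intros Hz Hw Hz1 Hw1 Hc Hm Hm1 E.
  set (D := (w - z)%C) in *. set (n := (c * (m - 1) * D)%C) in *.
  assert (HD : Cmod D <= 2 / 1000).
  { unfold D. replace (w - z)%C with ((1 - z) + - (1 - w))%C by ring.
    eapply Rle_trans; [apply Cmod_triangle|]. rewrite Cmod_opp. lra. }
  assert (D0 := Cmod_ge_0 D).
  assert (Hc1 : 9 / 10 <= Cmod c <= 11 / 10).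
  { split.
    - assert (H := Cmod_triangle_rev 1 (c - 1)). replace (1 + (c - 1))%C with c in H by ring.
      rewrite Cmod_1 in H. lra.
    - assert (H := Cmod_triangle 1 (c - 1)). replace (1 + (c - 1))%C with c in H by ring.
      rewrite Cmod_1 in H. lra. }
  assert (Hn : Cmod n <= 231 / 100 * Cmod D).
  { unfold n. rewrite !Cmod_mult. apply Rmult_le_compat_r; [easy|].
    replace (231 / 100) with (11 / 10 * (21 / 10)) by field.
    apply Rmult_le_compat; try apply Cmod_ge_0; lra. }
  assert (T := Cmod_cexp_taylor2 n ltac:(lra)).
  assert (N0 := Cmod_ge_0 n).
  (* On the right, [1 - w] is small and the Taylor remainder is quadratic in the small [D]. *)
  assert (EQ : (D * (c * m + - (c - 1)) = (1 - w) * n + - (w * (cexp n - 1 - n)))%C).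
  { replace (w * (cexp n - 1 - n))%C with (w * (cexp n - 1) - w * n)%C by ring.
    rewrite <- E. unfold n, D. ring. }
  assert (UP : Cmod (D * (c * m + - (c - 1))) <= 1 / 5 * Cmod D).
  { rewrite EQ. eapply Rle_trans; [apply Cmod_triangle|]. rewrite Cmod_opp, !Cmod_mult.
    assert (P := Cmod_ge_0 (cexp n - 1 - n)). assert (P' := Cmod_ge_0 w).
    assert (P1 := Cmod_ge_0 (1 - w)).
    unfold in_disc in Hw.
    assert (Cmod (1 - w) * Cmod n <= 1 / 1000 * (231 / 100 * Cmod D))
      by (apply Rmult_le_compat; lra).
    assert (Cmod w * Cmod (cexp n - 1 - n) <= 1 * Cmod (cexp n - 1 - n))
      by (apply Rmult_le_compat_r; lra).
    assert (Cmod n * Cmod n <= (231 / 100 * Cmod D) * (231 / 100 * (2 / 1000)))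
      by (apply Rmult_le_compat; lra).
    lra. }
  assert (LOW : 1 / 2 <= Cmod (c * m + - (c - 1))).
  { assert (H := Cmod_triangle_rev (c * m) (- (c - 1))). rewrite Cmod_opp, Cmod_mult in H. nra. }
  rewrite Cmod_mult in UP.
  assert (Z : Cmod D = 0) by nra.
  apply Cmod_eq_0 in Z. replace z with (w - D)%C by (unfold D; ring). rewrite Z. ring.
Qed.

Lemma K_op_injective_wlog (c : C) :
  (forall z w, in_disc z -> in_disc w -> Cmod (1 - w) <= Cmod (1 - z) ->
     K_op spiral_log c z = K_op spiral_log c w -> z = w) ->
  forall z w, in_disc z -> in_disc w -> K_op spiral_log c z = K_op spiral_log c w -> z = w.
Proof.
  intros H z w Hz Hw E. destruct (Rle_dec (Cmod (1 - w)) (Cmod (1 - z))).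
  - now apply H.
  - symmetry. apply H; try easy. lra.
Qed.

Lemma K_op_injective_near_0 (c : C) : Cmod c <= 1 / 40 ->
  forall z w, in_disc z -> in_disc w -> K_op spiral_log c z = K_op spiral_log c w -> z = w.
Proof.
  intros Hc. apply K_op_injective_wlog. intros z w Hz Hw Hzw HK.
  destruct (K_op_collision c z w Hz Hw Hzw HK) as (m & k & -> & Hk & E).
  apply (collision_contraction (c * (pow_ieps (1 - z) + k - 1))); try easy.
  apply Rle_trans with (1 / 40 * (21 / 10)); [|lra].
  now apply Cmod_mult_le; [|apply Cmod_slope_le].
Qed.

Lemma K_op_injective_near_1 (c : C) : Cmod (c - 1) <= 1 / 10 ->
  forall z w, in_disc z -> in_disc w -> K_op spiral_log c z = K_op spiral_log c w -> z = w.
Proof.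
  intros Hc. apply K_op_injective_wlog. intros z w Hz Hw Hzw HK.
  destruct (K_op_collision c z w Hz Hw Hzw HK) as (m & k & -> & Hk & E).
  assert (W := Cmod_pow_ieps (1 - z)).
  (* Above the threshold the slope is at most [1/100 + 1/50]; below it, [|1 - w| <= |1 - z|] puts
     both points near 1. *)
  destruct (Rle_dec (1 / 1000) (Cmod (1 - z))) as [h | h].
  - apply (collision_contraction (c * (pow_ieps (1 - z) + k - 1))); try easy.
    apply Rle_trans with (11 / 10 * (3 / 100)); [|lra].
    apply Cmod_mult_le.
    + replace c with (1 + (c - 1))%C by ring. replace (11 / 10) with (1 + 1 / 10) by field.
      apply Cmod_plus_le; [rewrite Cmod_1; lra | easy].
    + replace (pow_ieps (1 - z) + k - 1)%C with ((pow_ieps (1 - z) - 1) + k)%C by ring.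
      replace (3 / 100) with (1 / 100 + 1 / 50) by field.
      apply Cmod_plus_le; [|easy]. apply Cmod_pow_ieps_minus_1; [now apply in_disc_right|].
      split; [easy|]. assert (H := Cmod_triangle 1 (- z)). rewrite Cmod_opp, Cmod_1 in H.
      unfold in_disc in Hz. unfold Cminus. lra.
  - apply (collision_near_1 c (pow_ieps (1 - z) + k)); try easy; try lra.
    + assert (H := Cmod_triangle_rev (pow_ieps (1 - z)) k). lra.
    + now apply Cmod_slope_le.
Qed.

(** * Derivatives of [g] and of [K_c] *)

Lemma cderiv_ext (f h : C -> C) (x l m : C) :
  (forall y, f y = h y) -> l = m -> cderiv f x l -> cderiv h x m.
Proof.
  intros E <- H e He. destruct (H e He) as [d [Hd Hy]]. exists d; split; [easy|].
  intros y D. rewrite <- !E. auto.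
Qed.

Lemma cderiv_affine (a b x : C) : cderiv (fun y => a + b * y)%C x b.
Proof.
  apply (cderiv_ext (fun y => a + b * y)%C _ x (0 + (0 * x + b * 1))%C); [easy | ring |].
  apply cderiv_plus; [apply cderiv_const|].
  apply cderiv_mult; [apply cderiv_const | apply cderiv_id].
Qed.

Lemma cderiv_pow (u : C) : 0 < fst u ->
  cderiv (fun v => v * pow_ieps v)%C u ((1 + ieps) * pow_ieps u)%C.
Proof.
  intros Hu. assert (N := right_neq_0 u Hu).
  apply (cderiv_ext (fun v => v * pow_ieps v)%C _ u
    (1 * pow_ieps u + u * ((0 * Clog u + ieps * / u) * pow_ieps u))%C); [easy | now field |].
  apply cderiv_mult; [apply cderiv_id|].
  apply (cderiv_comp cexp (fun v => ieps * Clog v)%C); [apply cderiv_cexp|].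
  apply cderiv_mult; [apply cderiv_const | now apply cderiv_Clog].
Qed.

Lemma cderiv_spiral_log (z : C) : in_disc z ->
  cderiv spiral_log z (pow_ieps (1 - z) - 1)%C.
Proof.
  intros Hz. assert (N := one_plus_ieps_neq_0).
  set (P := fun v => (v * pow_ieps v)%C).
  assert (H1 : cderiv (fun y => P (1 + - (1) * y))%C z (- (1) * ((1 + ieps) * pow_ieps (1 - z)))%C).
  { apply (cderiv_comp P (fun y => 1 + - (1) * y)%C).
    - replace (1 + - (1) * z)%C with (1 - z)%C by ring.
      apply cderiv_pow. now apply in_disc_right.
    - apply cderiv_affine. }
  assert (H2 := cderiv_comp _ _ z _ _ (cderiv_affine (/ (1 + ieps)) (- / (1 + ieps)) _) H1).
  assert (H3 := cderiv_plus _ _ z _ _ H2 (cderiv_affine 0 (- (1)) z)).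
  revert H3. apply cderiv_ext.
  - intros y. unfold spiral_log, P. replace (1 + - (1) * y)%C with (1 - y)%C by ring. now field.
  - now field.
Qed.

Lemma cderiv_K_op (c z : C) : in_disc z ->
  cderiv (K_op spiral_log c) z
    (cexp (c * spiral_log z) * (1 + c * z * (pow_ieps (1 - z) - 1)))%C.
Proof.
  intros Hz.
  apply (cderiv_ext (fun y => y * cexp (c * spiral_log y))%C _ z
    (1 * cexp (c * spiral_log z) + z *
      ((0 * spiral_log z + c * (pow_ieps (1 - z) - 1)) * cexp (c * spiral_log z)))%C); [easy | ring |].
  apply (cderiv_mult (fun y => y) (fun y => cexp (c * spiral_log y))%C); [apply cderiv_id|].
  apply (cderiv_comp cexp (fun y => c * spiral_log y)%C); [apply cderiv_cexp|].
  apply cderiv_mult; [apply cderiv_const | now apply cderiv_spiral_log].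
Qed.

Lemma K_op_analytic (c : C) : analytic_on_disc (K_op spiral_log c).
Proof. intros z Hz. eexists. apply is_derive_cderiv, cderiv_K_op, Hz. Qed.

(** * Critical points on the real axis exclude [c] from the interior *)

Lemma locally_Cmod (c : C) (S : C -> Prop) :
  locally c S <-> exists d, 0 < d /\ forall b, Cmod (b - c) < d -> S b.
Proof.
  split.
  - intros [d Hd]. exists d. split; [apply cond_pos|].
    intros b Hb. apply Hd, C_NormedModule_mixin_compat1, Hb.
  - intros [d [Hd H]].
    apply (locally_le_locally_norm (V := C_NormedModule)).
    exists (mkposreal d Hd). intros b Hb. apply H, Hb.
Qed.

(* Collisions [K_b(x + h) = K_b(x)] occur for [b] the negative ratio of the
   increments of [log] and [g], and [b] tends to [c] as [h -> 0]: a critical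
   point of [K_c] need not be resolved by a local normal form. *)
Lemma critical_not_interior (g : C -> C) (c l : C) (x : R) :
  0 < x < 1 -> cderiv g (RtoC x) l -> (1 + c * x * l = 0)%C ->
  ~ interior_set (U_set g) c.
Proof.
  intros Hx Hg Hc HI. apply locally_Cmod in HI. destruct HI as [d [Hd HU]].
  assert (Hx0 : RtoC x <> 0%C) by (apply Cmod_gt_0; rewrite Cmod_R, Rabs_pos_eq; lra).
  assert (Hl : 0 < Cmod l).
  { apply Cmod_gt_0. intros ->. apply C1_nz. rewrite <- Hc. ring. }
  assert (Cc := Cmod_ge_0 c).
  (* The first bound gives [|q2| >= |l| / 2]; the second then gives [e (1 + |c|) < d |q2|], which
     places [b] within [d] of [c]. *)
  set (e := Rmin (Cmod l / 2) (d * Cmod l / (4 * (1 + Cmod c)))).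
  assert (He1 : e <= Cmod l / 2) by apply Rmin_l.
  assert (He2 : e * (1 + Cmod c) <= d * Cmod l / 4).
  { replace (d * Cmod l / 4) with (d * Cmod l / (4 * (1 + Cmod c)) * (1 + Cmod c)) by (field; lra).
    apply Rmult_le_compat_r; [lra | apply Rmin_r]. }
  assert (He : 0 < e).
  { apply Rmin_pos; [lra|]. apply Rdiv_lt_0_compat; [now apply Rmult_lt_0_compat | lra]. }
  destruct (Hg e He) as [d1 [Hd1 Q2]].
  destruct (derivable_pt_lim_ln x (proj1 Hx) e He) as [d2 Q1].
  set (h := Rmin (Rmin d1 d2) (1 - x) / 2).
  assert (Hh : 0 < h /\ h < d1 /\ h < d2 /\ h < 1 - x).
  { assert (M1 := Rmin_l (Rmin d1 d2) (1 - x)). assert (M2 := Rmin_r (Rmin d1 d2) (1 - x)).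
    assert (M3 := Rmin_l d1 d2). assert (M4 := Rmin_r d1 d2).
    assert (0 < Rmin (Rmin d1 d2) (1 - x)) by (repeat apply Rmin_pos; try lra; apply cond_pos).
    unfold h; lra. }
  destruct Hh as (h0 & h1 & h2 & h3).
  assert (Hh0 : RtoC h <> 0%C) by (apply Cmod_gt_0; rewrite Cmod_R, Rabs_pos_eq; lra).
  assert (Hxh : (RtoC (x + h) - RtoC x = RtoC h)%C) by (rewrite RtoC_plus; ring).
  specialize (Q2 (RtoC (x + h))). rewrite Hxh, Cmod_R, Rabs_pos_eq in Q2 by lra.
  specialize (Q2 h1).
  specialize (Q1 h ltac:(lra)). rewrite (Rabs_pos_eq h) in Q1 by lra. specialize (Q1 h2).
  set (q1 := (ln (x + h) - ln x) / h) in *.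
  set (q2 := ((g (RtoC (x + h)) - g (RtoC x)) / h)%C).
  assert (Q2' : Cmod (q2 - l) <= e).
  { replace (q2 - l)%C with ((g (RtoC (x + h)) - g (RtoC x) - h * l) / h)%C by (unfold q2; now field).
    rewrite Cmod_div, Cmod_R, Rabs_pos_eq by (easy || lra).
    apply (Rmult_le_reg_r h); [lra|]. unfold Rdiv; rewrite Rmult_assoc, Rinv_l by lra. lra. }
  assert (Q2'' : Cmod l / 2 <= Cmod q2).
  { assert (H := Cmod_triangle_rev l (q2 - l)). replace (l + (q2 - l))%C with q2 in H by ring. lra. }
  assert (Nq2 : q2 <> 0%C) by (apply Cmod_gt_0; lra).
  set (b := (- (RtoC q1) / q2)%C).
  assert (Hb : U_set g b).
  { apply HU.
    (* The critical equation reads [1 / x + c l = 0], so both quotient errors may be inserted into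
       [q1 + c q2] at no cost. *)
    assert (E : (b - c = - ((RtoC q1 - / x) + c * (q2 - l)) / q2)%C).
    { replace (RtoC q1 - / x + c * (q2 - l))%C
        with (RtoC q1 + c * q2 - (1 + c * x * l) / x)%C by (now field).
      rewrite Hc. unfold b. field. split; easy. }
    rewrite E, Cmod_div, Cmod_opp by easy.
    apply (Rmult_lt_reg_r (Cmod q2)); [lra|].
    unfold Rdiv; rewrite Rmult_assoc, Rinv_l, Rmult_1_r by lra.
    apply Rle_lt_trans with (e + Cmod c * e); [|nra].
    apply Cmod_plus_le.
    - rewrite <- RtoC_inv, <- RtoC_minus, Cmod_R by lra. lra.
    - apply Cmod_mult_le; [apply Rle_refl | easy]. }
  destruct Hb as [_ Inj].
  assert (D1 : in_disc (RtoC (x + h))) by (unfold in_disc; rewrite Cmod_R, Rabs_pos_eq; lra).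
  assert (D2 : in_disc (RtoC x)) by (unfold in_disc; rewrite Cmod_R, Rabs_pos_eq; lra).
  assert (X : RtoC (x + h) = RtoC x); [apply Inj; try easy | apply RtoC_inj in X; lra].
  unfold K_op.
  (* For real [x > 0], [K_b(x) = exp (ln x + b g(x))], and the choice of [b] makes the increment of
     this exponent vanish. *)
  transitivity (cexp (ln (x + h)) * cexp (b * g (RtoC (x + h))))%C;
    [now rewrite cexp_RtoC, exp_ln by lra|].
  transitivity (cexp (ln x) * cexp (b * g (RtoC x)))%C;
    [|now rewrite cexp_RtoC, exp_ln by lra].
  rewrite <- !cexp_plus. f_equal.
  assert (G : g (RtoC (x + h)) = (g (RtoC x) + h * q2)%C) by (unfold q2; now field).
  assert (L : ln (x + h) = ln x + h * q1) by (unfold q1; field; lra).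
  rewrite G, L, RtoC_plus, RtoC_mult. unfold b. now field.
Qed.

(** * The separating curve *)

(** For [Re c > 0], this is an [x] for which [w = (1 - x)^(i eps)] is the point of the unit circle
    where [1 / (1 - w)] has the argument of [c]. The angle [PI + 2 arg c] is positive, which puts
    [x] in (0, 1). *)
Definition crit_point (c : C) : R := 1 - exp (- ((PI + 2 * atan (snd c / fst c)) / eps)).

(** Once the arguments agree, [c x = 1 / (1 - w)] reduces to its real part [Re c x = 1/2]; the level
    1 of this function is the curve. *)
Definition crit_locus (c : C) : R := 2 * fst c * crit_point c.

Lemma crit_point_bounds (c : C) : 0 < crit_point c < 1.
Proof.
  unfold crit_point. assert (A := atan_bound (snd c / fst c)).
  assert (P := exp_pos (- ((PI + 2 * atan (snd c / fst c)) / eps))).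
  split; [|lra].
  assert (0 < (PI + 2 * atan (snd c / fst c)) / eps).
  { apply Rdiv_lt_0_compat; [lra | rewrite eps_val; lra]. }
  assert (exp (- ((PI + 2 * atan (snd c / fst c)) / eps)) < exp 0) by (apply exp_increasing; lra).
  rewrite exp_0 in *. lra.
Qed.

Lemma pow_ieps_crit_point (c : C) :
  pow_ieps (1 - crit_point c) =
    (- cos (2 * atan (snd c / fst c)), sin (2 * atan (snd c / fst c))).
Proof.
  set (t := 2 * atan (snd c / fst c)).
  assert (He : 0 < eps) by (rewrite eps_val; lra).
  unfold crit_point. fold t.
  replace (1 - RtoC (1 - exp (- ((PI + t) / eps))))%C
    with (RtoC (exp (- ((PI + t) / eps)))) by (rewrite RtoC_minus; ring).
  unfold pow_ieps, Clog. rewrite Cmod_R, Rabs_pos_eq, ln_exp by apply Rlt_le, exp_pos.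
  unfold cexp, ieps; simpl.
  replace (0 / exp (- ((PI + t) / eps))) with 0
    by (field; apply Rgt_not_eq, exp_pos).
  rewrite atan_0, !Rmult_0_l, Rmult_0_r, Rminus_0_r, exp_0, !Rmult_1_l, Rplus_0_l.
  replace (eps * - ((PI + t) / eps)) with (- (t + PI)) by (field; lra).
  rewrite cos_neg, sin_neg, neg_cos, neg_sin. now rewrite Ropp_involutive.
Qed.

Lemma crit_locus_not_interior (c : C) :
  0 < fst c -> crit_locus c = 1 -> ~ interior_set (U_set spiral_log) c.
Proof.
  intros Ha HH.
  assert (B := crit_point_bounds c).
  apply (critical_not_interior spiral_log c (pow_ieps (1 - crit_point c) - 1)%C (crit_point c)); [easy| |].
  - apply cderiv_spiral_log. unfold in_disc. rewrite Cmod_R, Rabs_pos_eq; lra.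
  - rewrite pow_ieps_crit_point. unfold crit_locus in HH.
    set (x := crit_point c) in *. clearbody x. destruct c as [a b]; simpl fst in *; simpl snd in *.
    set (t := b / a).
    assert (Hb : b = a * t) by (unfold t; field; lra). clearbody t. subst b.
    assert (T := Rle_0_sqr t).
    assert (S2 : sqrt (1 + t²) * sqrt (1 + t²) = 1 + t²) by (apply sqrt_sqrt; lra).
    assert (S0 : 0 < sqrt (1 + t²)) by (apply sqrt_lt_R0; lra).
    assert (Ec := cos_atan t). assert (Es := sin_atan t).
    set (s := sqrt (1 + t²)) in *. clearbody s.
    (* The double-angle formulas give [w - 1 = -2 (1 - i t) / (1 + t^2)]. As [c = a (1 + i t)], the
       product [c (w - 1)] is [-2 a]. *)
    assert (E1 : cos (2 * atan t) = 2 / (1 + t²) - 1).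
    { rewrite cos_2a_cos, Ec, <- S2. field. lra. }
    assert (E2 : sin (2 * atan t) = 2 * t / (1 + t²)).
    { rewrite sin_2a, Ec, Es, <- S2. field. lra. }
    rewrite E1, E2. unfold Rsqr in *.
    apply injective_projections; simpl.
    + transitivity (1 - 2 * a * x); [field; lra | lra].
    + field; lra.
Qed.

Lemma continuous_crit_locus (c : C) : 0 < fst c ->
  continuous (T := C_UniformSpace) (U := R_UniformSpace) crit_locus c.
Proof.
  intros Ha.
  assert (Cf : continuous (T := C_UniformSpace) (U := R_UniformSpace) (fun b : C => fst b) c)
    by (destruct c; apply (continuous_fst (U := R_UniformSpace) (V := R_UniformSpace))).
  assert (Cs : continuous (T := C_UniformSpace) (U := R_UniformSpace) (fun b : C => snd b) c)
    by (destruct c; apply (continuous_snd (U := R_UniformSpace) (V := R_UniformSpace))).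
  unfold crit_locus, crit_point.
  apply (continuous_mult (K := R_AbsRing) (fun b : C => 2 * fst b)).
  { apply (continuous_scal_r (K := R_AbsRing) (V := R_NormedModule) 2 (fun b : C => fst b)), Cf. }
  apply (continuous_comp (fun b : C => snd b / fst b)
    (fun t => 1 - exp (- ((PI + 2 * atan t) / eps)))).
  - apply (continuous_mult (K := R_AbsRing) (fun b : C => snd b)); [apply Cs|].
    apply (continuous_comp (fun b : C => fst b) Rinv); [apply Cf|].
    apply continuous_Rinv; lra.
  - apply (ex_derive_continuous (K := R_AbsRing) (V := R_NormedModule)).
    auto_derive. easy.
Qed.

Lemma locally_right (c : C) (P : R -> Prop) :
  open P -> 0 < fst c -> P (crit_locus c) ->
  locally (T := C_UniformSpace) c (fun b : C => 0 < fst b /\ P (crit_locus b)).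
Proof.
  intros HP Ha Hc. apply filter_and.
  - destruct c as [a b]. 
    apply (continuous_fst (U := R_UniformSpace) (V := R_UniformSpace) a b (fun t => 0 < t)).
    now apply (open_gt 0).
  - apply (continuous_crit_locus c Ha P). now apply HP.
Qed.

(** The half-plane [Re c < 1/4] is joined to the side below level 1, so that openness on the
    imaginary axis does not depend on [snd c / fst c], which is discontinuous there. *)
Lemma crit_locus_separates (a b : C) :
  fst a < 1 / 4 -> 0 < fst b -> 1 < crit_locus b ->
  ~ same_component (interior_set (U_set spiral_log)) a b.
Proof.
  intros Ha Hb Hb1 (Q & HQ & Hconn & Qa & Qb).
  destruct (Hconn
    (fun c => fst c < 1 / 4 \/ (0 < fst c /\ crit_locus c < 1))
    (fun c => 0 < fst c /\ 1 < crit_locus c)) as (z & Qz & [Az | [_ Az]] & Bz0 & Bz); try lra.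
  - apply open_or; intros c Hc.
    + destruct c as [x y].
      apply (continuous_fst (U := R_UniformSpace) (V := R_UniformSpace) x y (fun t => t < 1 / 4)).
      now apply (open_lt (1 / 4)).
    + apply (locally_right c (fun t => t < 1)); try easy. apply open_lt.
  - intros c Hc. apply (locally_right c (fun t => 1 < t)); try easy. apply open_gt.
  - intros z Qz. destruct (Rlt_dec (fst z) (1 / 4)) as [h | h]; [now left; left|].
    destruct (Rtotal_order (crit_locus z) 1) as [h1 | [h1 | h1]].
    + left; right. split; [lra | easy].
    + exfalso. apply (crit_locus_not_interior z); [lra | easy | now apply HQ].
    + right. split; [lra | easy].
  - exists a. split; [easy | now left].
  - exists b. easy.
  (* Disjointness: a level above 1 forces [Re z > 1/2], since the critical point is below 1. *)
  - assert (B := crit_point_bounds z). unfold crit_locus in Bz. nra.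
Qed.

Lemma crit_locus_1 : 1 < crit_locus 1.
Proof.
  unfold crit_locus, crit_point. simpl.
  replace (0 / 1) with 0 by field. rewrite atan_0, Rmult_0_r, Rplus_0_r.
  assert (HP := PI2_1). rewrite exp_Ropp.
  assert (L : 2 < exp (PI / eps)).
  { assert (H := exp_ineq1_le (PI / eps)).
    replace (PI / eps) with (PI * 10000) in * by (rewrite eps_val; field). lra. }
  assert (/ exp (PI / eps) < / 2) by (apply Rinv_lt_contravar; lra).
  lra.
Qed.

(** * Normalisation and conclusion *)

Lemma spiral_log_0 : spiral_log 0 = 0%C.
Proof.
  unfold spiral_log, pow_ieps, Clog.
  replace (1 - 0)%C with (RtoC 1) by ring. rewrite Cmod_1, ln_1. simpl.
  replace (0 / 1) with 0 by field. rewrite atan_0.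
  replace (ieps * (0, 0))%C with (RtoC 0) by (apply injective_projections; simpl; ring).
  rewrite cexp_0. field. apply one_plus_ieps_neq_0.
Qed.

Theorem theorem1p4 :
  exists f : C -> C,
    univalent_on_disc f /\ f (RtoC 0) = RtoC 0 /\
    @is_derive C_AbsRing C_NormedModule f (RtoC 0) (RtoC 1) /\
    exists g : C -> C,
      is_Log_f_over_z f g /\
      at_least_two_components (interior_set (U_set g)).
Proof.
  assert (D0 : in_disc 0) by (unfold in_disc; rewrite Cmod_0; lra).
  (* Since [f] is [K_1[f]], its univalence is the case [c = 1] of injectivity near 1. *)
  exists (K_op spiral_log 1). split; [|split; [|split]].
  - split; [apply K_op_analytic|]. apply K_op_injective_near_1.
    replace (1 - 1)%C with (RtoC 0) by ring. rewrite Cmod_0. lra.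
  - unfold K_op. ring.
  - apply is_derive_cderiv.
    apply (cderiv_ext _ _ _ _ _ (fun y => eq_refl)) with (2 := cderiv_K_op 1 0 D0).
    rewrite spiral_log_0, Cmult_0_r, cexp_0. ring.
  - exists spiral_log. split; [split; [|split]|].
    + intros z Hz. eexists. apply is_derive_cderiv, cderiv_spiral_log, Hz.
    + apply spiral_log_0.
    + intros z _. unfold K_op. now rewrite Cmult_1_l.
    (* Discs of radius 1/40 about 0 and 1/10 about 1 lie in [U_f], and the curve separates their
       centres. *)
    + exists 0%C, 1%C. split; [|split].
      * apply locally_Cmod. exists (1 / 40). split; [lra|]. intros b Hb.
        split; [apply K_op_analytic|]. apply K_op_injective_near_0.
        replace (b - 0)%C with b in Hb by ring. lra.
      * apply locally_Cmod. exists (1 / 10). split; [lra|]. intros b Hb.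
        split; [apply K_op_analytic|]. apply K_op_injective_near_1. lra.
      * apply crit_locus_separates; [simpl; lra | simpl; lra | apply crit_locus_1].
Qed.
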